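(* Let $\mathcal{H}$ be a real Hilbert space, $\mathcal{Y} \subset \mathcal{H}$ and $f : \mathcal{Y} \to \mathcal{H}$. Consider three functions $\varphi, g, \psi:\mathcal{H}\to\mathbb{R}\cup\{+\infty\}$ such that: $f(y)\in\mathrm{prox}_\varphi(y)$ for each $y\in\mathcal{Y}$; $g$ is convex lower semicontinuous and $f^{-1}(x)\subset\partial g(x)$ for each $x\in\mathrm{Im}(f)$; $\psi$ is convex lower semicontinuous and $f(y)\in\partial\psi(y)$ for each $y\in\mathcal{Y}$. Let $k \geq 0$ be an integer. (a) Consider an open set $\mathcal{V} \subset \mathcal{Y}$. The following two properties are equivalent: (i) $\psi$ is $C^{k+1}(\mathcal{V})$; (ii) $f$ is $C^k(\mathcal{V})$. When one of them holds, we have $f(y) = \nabla \psi(y)$ for all $y \in \mathcal{V}$. (b) Consider an open set $\mathcal{X} \subset \mathrm{Im}(f)$. The following three properties are equivalent: (i) $\varphi$ is $C^{k+1}(\mathcal{X})$; (ii) $g$ is $C^{k+1}(\mathcal{X})$; (iii) the restriction $\widetilde f$ of $f$ to the set $f^{-1}(\mathcal{X})$ is injective and $(\widetilde f)^{-1}$ is $C^k(\mathcal{X})$. When one of them holds, $\widetilde f$ is a bijection between $f^{-1}(\mathcal{X})$ and $\mathcal{X}$, and we have $$(\widetilde f)^{-1}(x) = \nabla g(x) = x+\nabla\varphi (x),\quad \forall x \in \mathcal{X}.$$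
   Context: For $\varphi: \mathcal{H} \to \mathbb{R}\cup\{+\infty\}$, $\mathrm{prox}_\varphi(y) := \arg\min_{x \in \mathcal{H}} \{\tfrac12\|y-x\|^2 + \varphi(x)\}$ is the set of global minimizers (a minimizer is required to have finite objective value). $\mathrm{Im}(f)=f(\mathcal{Y})$, and $f^{-1}(\cdot)$ denotes preimage in $\mathcal{Y}$. For $\theta:\mathcal{H}\to\mathbb{R}\cup\{+\infty\}$, $\partial\theta(x)$ is the set of $u\in\mathcal{H}$ with $\theta(x')\geq\theta(x)+\langle u,x'-x\rangle$ for all $x'\in\mathcal{H}$ when $\theta(x)<+\infty$, and $\partial\theta(x)=\varnothing$ when $\theta(x)=+\infty$. $C^k(\mathcal{X})$ means $k$ times continuously Fréchet differentiable (and finite, for extended-valued functions) on the open set $\mathcal{X}$; $C^0$ means continuous. *)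

(* Defs.v *)
From HB Require Import structures.
From mathcomp Require Import all_boot all_order all_algebra sesquilinear.
From mathcomp Require Import all_classical all_reals all_analysis.

Set Implicit Arguments.
Unset Strict Implicit.
Unset Printing Implicit Defensive.

Import Order.TTheory GRing.Theory Num.Theory.
Import numFieldNormedType.Exports.

Local Open Scope classical_set_scope.
Local Open Scope ring_scope.

(** * Continuous linear maps with the operator norm

   The iterated Fréchet derivatives of a map V -> W take their values in
   L(V, W), L(V, L(V, W)), ..., normed by the operator norm. *)

Section ContinuousLinear.
Context {R : realType} (V W : normedModType R).

Definition contlin : {pred V -> W} :=
  [pred f : V -> W | `[< linear f /\ continuous f >]].

Fact contlin_submod_closed : submod_closed contlin.
Proof.
split=> [|a f g /asboolP[lf cf] /asboolP[lg cg]]; apply/asboolP; split.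
- by move=> a x y /=; rewrite scaler0 addr0.
- exact: cst_continuous.
- move=> b x y /=; rewrite !fctE lf lg !scalerDr !scalerA.
  by rewrite (mulrC b) addrACA.
- by move=> x; apply: cvgD; [apply: cvgZr; exact: cf|exact: cg].
Qed.

HB.instance Definition _ := GRing.isSubmodClosed.Build R (V -> W) contlin
  contlin_submod_closed.

Record contlinMap := ContlinMap {
  contlin_fun :> V -> W;
  contlin_mem : contlin_fun \in contlin }.

HB.instance Definition _ := [isSub for contlin_fun].
HB.instance Definition _ := [Choice of contlinMap by <:].
HB.instance Definition _ := [SubChoice_isSubLmodule of contlinMap by <:].

Definition opnorm (u : contlinMap) : R :=
  sup [set `|u x| | x in [set x : V | `|x| <= 1]].

Lemma contlin_linear (u : contlinMap) : linear u.
Proof. by have /asboolP[] := contlin_mem u. Qed.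

Lemma contlin_continuous (u : contlinMap) : continuous u.
Proof. by have /asboolP[] := contlin_mem u. Qed.

Let has_sup_opnorm (u : contlinMap) :
  has_sup [set `|u x| | x in [set x : V | `|x| <= 1]].
Proof.
split; first by exists `|u 0|, 0 => //=; rewrite normr0.
pose mf := GRing.isLinear.Build R V W *:%R u (contlin_linear u).
pose f : {linear V -> W} := HB.pack (contlin_fun u) mf.
have /bounded_funP/(_ 1)[M uM] : bounded_near f (nbhs (0 : V)).
  by apply/linear_bounded_continuous; exact: contlin_continuous.
by exists M => _ [x /= x1 <-]; exact: uM.
Qed.

Lemma opnorm_ub (u : contlinMap) x : `|x| <= 1 -> `|u x| <= opnorm u.
Proof.
by move=> x1; apply: ub_le_sup; [case: (has_sup_opnorm u)|exists x].
Qed.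

Lemma opnorm_le (u : contlinMap) M :
  (forall x, `|x| <= 1 -> `|u x| <= M) -> opnorm u <= M.
Proof.
move=> uM; apply: ge_sup; first by case: (has_sup_opnorm u).
by move=> _ [x /= x1 <-]; exact: uM.
Qed.

Let opnorm_ge0 u : 0 <= opnorm u.
Proof. by apply: le_trans (@opnorm_ub u 0 _); rewrite ?normr0. Qed.

Fact ler_opnormD u v : opnorm (u + v) <= opnorm u + opnorm v.
Proof.
apply: opnorm_le => x x1; rewrite (le_trans (ler_normD _ _))//.
by rewrite lerD// opnorm_ub.
Qed.

Let opnormZ_le l u : opnorm (l *: u) <= `|l| * opnorm u.
Proof.
by apply: opnorm_le => x x1; rewrite /= normrZ ler_wpM2l// opnorm_ub.
Qed.

Fact opnormZ l u : opnorm (l *: u) = `|l| * opnorm u.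
Proof.
apply/le_anti; rewrite opnormZ_le/=.
have [->|l0] := eqVneq l 0; first by rewrite normr0 mul0r.
rewrite -ler_pdivlMl ?normr_gt0// -normfV.
by apply: le_trans (opnormZ_le _ _); rewrite scalerA mulVf// scale1r.
Qed.

Fact opnorm0_eq0 u : opnorm u = 0 -> u = 0.
Proof.
move=> u0; apply/val_inj/funext => x /=.
have ulin := contlin_linear u.
have uZ a y : u (a *: y) = a *: u y.
  have u00 : u 0 = 0.
    by have := ulin (-1) 0 0; rewrite !scaleN1r oppr0 addr0 addNr.
  by have := ulin a y 0; rewrite u00 !addr0.
have [->|x0] := eqVneq x 0; first by rewrite -(scale0r 0) uZ !scale0r.
have nx0 : `|x| != 0 by rewrite normr_eq0.
have : `|u (`|x|^-1 *: x)| <= 0.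
  by rewrite -u0 opnorm_ub// normrZ normfV normr_id mulVf.
rewrite normr_le0 uZ scaler_eq0 invr_eq0 (negPf nx0) /= => /eqP ->.
by [].
Qed.

HB.instance Definition _ := Lmodule_isNormed.Build R contlinMap
  ler_opnormD opnormZ opnorm0_eq0.

End ContinuousLinear.

(** * Maps of class C^k

   The maps below are total; on an open set X, [Ck k f X] only depends on the
   values of f on X. The derivative Df is only constrained on X. *)

Fixpoint Ck {R : realType} {V : normedModType R} (k : nat) :
    forall W : normedModType R, (V -> W) -> set V -> Prop :=
  match k with
  | 0%N => fun W f X => forall x, X x -> {for x, continuous f}
  | k'.+1 => fun W f X =>
      exists2 Df : V -> contlinMap V W,
        forall x, X x -> is_diff x f (Df x : V -> W)
        & Ck k' Df X
  end.
Arguments Ck {R V} k {W} f X.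

Definition Ck_ereal {R : realType} {V : normedModType R} (k : nat)
    (theta : V -> \bar R) (X : set V) : Prop :=
  (forall x, X x -> theta x \is a fin_num) /\
  Ck k (fine \o theta : V -> R^o) X.

(** * Functions on a real Hilbert space with values in R or +oo

   [dot] is the inner product; its compatibility with the norm of H is a
   hypothesis of the statements. *)

Section Hilbert.
Context {R : realType} {H : normedModType R} (dot : {dot H for @idfun R}).
Implicit Types (theta : H -> \bar R) (x y u : H).

Local Open Scope ereal_scope.

Definition prox theta y : set H :=
  [set x | theta x < +oo /\ forall x',
     (2^-1 * `|y - x| ^+ 2)%:E + theta x <=
     (2^-1 * `|y - x'| ^+ 2)%:E + theta x'].

Definition ereal_convex theta : Prop :=
  forall x y (t : R), (0 <= t <= 1)%R ->
    theta (t *: x + (1 - t) *: y)%R <= t%:E * theta x + (1 - t)%:E * theta y.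

Definition subdiff theta x : set H :=
  [set u | theta x < +oo /\
     forall x', theta x + (dot u (x' - x)%R)%:E <= theta x'].

(* u is the gradient of theta at x; theta is required to be finite around x so
   that [fine] does not hide the value +oo. *)
Definition is_gradient theta x u : Prop :=
  (\forall z \near x, theta z \is a fin_num) /\
  is_diff x (fine \o theta : H -> R^o) (fun h => dot u h : R^o).

End Hilbert.

(* Main.v *)
(* Let s select a subgradient of an extended-valued function theta at each point
   of an open set X. Where theta is Frechet differentiable, the subgradient is
   unique and equals the gradient; conversely, where s is continuous, the
   subgradient inequalities at x and x + h squeeze the first-order remainder of
   theta between 0 and <s (x + h) - s x, h>, so theta is differentiable with
   gradient s x. Hence theta is C^{k+1} on X iff s is C^k, by the Riesz
   isomorphism.
   Part (a) is the case theta = psi, s = f. For part (b), take for s a right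
   inverse of f: it selects subgradients of g by hypothesis, and also of
   phi + |.|^2/2: expanding the square, x is in prox_phi(y) iff y is a
   subgradient of this function at x. So phi and g are both C^{k+1} exactly when s is C^k. *)
Require Import Defs.
From HB Require Import structures.
From mathcomp Require Import all_boot all_order all_algebra sesquilinear.
From mathcomp Require Import all_classical all_reals all_analysis ring lra.

Set Implicit Arguments.
Unset Strict Implicit.
Unset Printing Implicit Defensive.

Import Order.TTheory GRing.Theory Num.Theory.
Import numFieldNormedType.Exports.

Local Open Scope classical_set_scope.
Local Open Scope ring_scope.

(** * Bounded linear maps and Fréchet derivatives *)

HB.instance Definition _ (R : realType) (V W : normedModType R)
  (u : contlinMap V W) :=
  GRing.isLinear.Build R V W *:%R (contlin_fun u) (contlin_linear u).

Section ContinuousLinear.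
Context {R : realType} {V W : normedModType R}.

(** By homogeneity: rescale [x] to the unit sphere, where [opnorm_ub] applies. *)
Lemma opnorm_bound (u : contlinMap V W) x : `|u x| <= `|u| * `|x|.
Proof.
have [->|x0] := eqVneq x 0; first by rewrite linear0 !normr0 mulr0.
have nx0 : 0 < `|x| by rewrite normr_gt0.
rewrite -ler_pdivrMr// -[X in X <= _]ger0_norm ?divr_ge0//.
rewrite normrM normr_id normfV normr_id mulrC.
rewrite -[X in X * _]gtr0_norm ?invr_gt0// -normrZ -linearZ.
by apply: opnorm_ub; rewrite normrZ normfV normr_id mulVf ?gt_eqF.
Qed.

Lemma bounded_contlin (f : V -> W) (M : R) :
  linear f -> (forall x, `|f x| <= M * `|x|) -> f \in @contlin R V W.
Proof.
move=> lf fM; apply/asboolP; split=> //.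
pose mf := GRing.isLinear.Build R V W *:%R f lf.
pose g : {linear V -> W} := HB.pack f mf.
apply: (@bounded_linear_continuous _ _ _ g); apply/linear_boundedP.
near=> r => x; apply: (le_trans (fM x)); rewrite ler_wpM2r//.
Unshelve. all: by end_near. Qed.

(** The epsilon form of the first-order expansion. Continuity of the candidate derivative is carried
    by its type, so only the remainder has to be estimated. *)
Lemma is_diffP (f : V -> W) (df : contlinMap V W) x :
  is_diff x f df <-> forall e, 0 < e ->
    \forall h \near 0, `|f (h + x) - f x - df h| <= e * `|h|.
Proof.
have dfc : continuous df by exact: contlin_continuous.
suff E : is_diff x f df <-> f \o shift x = cst (f x) + df +o_ 0 id.
  have eqE h : (f \o shift x - (cst (f x) + df)) h = f (h + x) - f x - df h.
    by rewrite !fctE /= opprD addrA.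
  rewrite E; split=> [/eqaddoP|] fdf.
    by move=> e /fdf; apply: filterS => h; rewrite eqE.
  by apply/eqaddoP => e /fdf; apply: filterS => h; rewrite eqE.
split=> [[/diff_locallyP[_ H] dfE]|fE]; first by rewrite -dfE.
have d : 'd f x = df :> (V -> W) by exact: diff_unique.
by split=> //; apply/diff_locallyP; rewrite d.
Qed.

Lemma is_diff_contlin (u : contlinMap V W) x :
  is_diff x u u.
Proof.
apply/is_diffP => e e0; near=> h.
by rewrite linearD addrK subrr normr0 mulr_ge0// ltW.
Unshelve. all: by end_near. Qed.

End ContinuousLinear.

Section Composition.
Context {R : realType} {V W W' : normedModType R}.

Fact comp_contlin_subproof (L : contlinMap W W') (u : contlinMap V W) :
  L \o u \in @contlin R V W'.
Proof.
apply: (@bounded_contlin _ _ _ _ (`|L| * `|u|)) => [a x y /=|x /=].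
  by rewrite !linearP.
by rewrite (le_trans (opnorm_bound _ _))// -mulrA ler_wpM2l// opnorm_bound.
Qed.

Definition comp_contlin L u := ContlinMap (comp_contlin_subproof L u).

(** Since composing with [L] is itself bounded linear between operator spaces, the derivative of
    [L \o f] is again a continuous linear map applied to [Df]; this drives the induction in
    [Ck_comp_contlin]. *)
Fact postcomp_contlin_subproof (L : contlinMap W W') :
  comp_contlin L \in @contlin R (contlinMap V W) (contlinMap V W').
Proof.
apply: (@bounded_contlin _ _ _ _ `|L|) => [a u v|u].
  by apply/val_inj/funext => x /=; rewrite !fctE linearP.
apply: opnorm_le => x x1 /=; rewrite (le_trans (opnorm_bound _ _))//.
by rewrite ler_wpM2l// opnorm_ub.
Qed.

Definition postcomp_contlin L := ContlinMap (postcomp_contlin_subproof L).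

End Composition.

Fact id_contlin_subproof (R : realType) (V : normedModType R) :
  idfun \in @contlin R V V.
Proof.
apply: (@bounded_contlin _ _ _ _ 1) => [a x y|x]; first by [].
by rewrite mul1r.
Qed.

Definition id_contlin (R : realType) (V : normedModType R) : contlinMap V V :=
  ContlinMap (@id_contlin_subproof R V).

(** * Calculus of maps of class C^k *)

Section Ck_theory.
Context {R : realType} {V : normedModType R}.
Implicit Type X : set V.

Lemma Ck_continuous k (W : normedModType R) (f : V -> W) X x :
  Ck k f X -> X x -> {for x, continuous f}.
Proof.
case: k => [|k]; first exact.
by case=> Df fDf _ /fDf [/differentiable_continuous].
Qed.

(** Continuity and derivatives at a point depend only on the germ, and [X] is a neighbourhood of its
    points, so the same [Df] serves for [g]. *)
Lemma eq_Ck k (W : normedModType R) (f g : V -> W) X : open X ->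
  {in X, f =1 g} -> Ck k f X -> Ck k g X.
Proof.
move=> oX fg; have nfg x : X x -> \forall z \near x, f z = g z.
  move=> Xx; have : nbhs x X by exact: open_nbhs_nbhs.
  by apply: filterS => z Xz; apply: fg; rewrite inE.
case: k => [fc x Xx|k [Df fDf CDf]].
  rewrite /prop_for /continuous_at -(fg x) ?inE//.
  apply: cvg_trans (fc x Xx); apply: near_eq_cvg.
  by apply: filterS (nfg x Xx) => z ->.
exists Df => // x Xx; apply/is_diffP => e e0.
have /is_diffP /(_ e e0) := fDf x Xx.
have : \forall h \near 0, f (h + x) = g (h + x).
  by have := nfg x Xx; rewrite (near_shift 0) /= subr0.
by apply: filterS2 => h -> ; rewrite fg ?inE.
Qed.

Lemma Ck_cst k (W : normedModType R) (c : W) X : Ck k (cst c) X.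
Proof.
elim: k W c => [|k IH] W c /=; first by move=> x _; exact: cst_continuous.
by exists (cst 0) => // x _; exact: is_diff_cst.
Qed.

Lemma Ck_contlin k (W : normedModType R) (u : contlinMap V W) X : Ck k u X.
Proof.
case: k => [x _|k]; first exact: contlin_continuous.
by exists (cst u) => [x _|]; [exact: is_diff_contlin|exact: Ck_cst].
Qed.

Lemma Ck_comp_contlin k (W W' : normedModType R) (L : contlinMap W W')
  (f : V -> W) X : Ck k f X -> Ck k (L \o f) X.
Proof.
elim: k W W' L f => [|k IH] W W' L f /=.
  by move=> fc x Xx; apply: continuous_comp; [exact: fc|exact: contlin_continuous].
case=> Df fDf CDf; exists (postcomp_contlin L \o Df); last exact: IH.
move=> x Xx /=; have := fDf x Xx => ?; have ? := is_diff_contlin L (f x).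
exact: is_diff_comp.
Qed.

Lemma CkD k (W : normedModType R) (f g : V -> W) X :
  Ck k f X -> Ck k g X -> Ck k (f \+ g) X.
Proof.
elim: k W f g => [|k IH] W f g /=.
  by move=> fc gc x Xx; apply: cvgD; [exact: fc|exact: gc].
case=> Df fDf CDf [Dg gDg CDg]; exists (Df \+ Dg); last exact: IH.
move=> x Xx /=; have ? := fDf x Xx; have ? := gDg x Xx.
exact: is_diffD.
Qed.

End Ck_theory.

(** * Inner product and Riesz isomorphism *)

Section Riesz.
Context {R : realType} {H : completeNormedModType R}.
Context (dot : {dot H for @idfun R}).
Hypothesis norm_dot : forall x : H, `|x| ^+ 2 = dot x x.
Implicit Types x y h : H.

Lemma dotC x y : dot x y = dot y x.
Proof. by rewrite hermC /= expr0 mul1r. Qed.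

Lemma dotDl x y z : dot (x + y) z = dot x z + dot y z.
Proof. by rewrite linearDl. Qed.

Lemma dotZl a x y : dot (a *: x) y = a * dot x y.
Proof. by rewrite linearZl_LR. Qed.

Lemma dotDr x y z : dot x (y + z) = dot x y + dot x z.
Proof. by rewrite dotC dotDl !(dotC _ x). Qed.

Lemma dotZr a x y : dot x (a *: y) = a * dot x y.
Proof. by rewrite dotC dotZl dotC. Qed.

Lemma dotNl x y : dot (- x) y = - dot x y.
Proof. by rewrite -scaleN1r dotZl mulN1r. Qed.

Lemma dotNr x y : dot x (- y) = - dot x y.
Proof. by rewrite dotC dotNl dotC. Qed.

Lemma sqr_normD x y : `|x + y| ^+ 2 = `|x| ^+ 2 + 2 * dot x y + `|y| ^+ 2.
Proof. by rewrite !norm_dot dotDl !dotDr (dotC y x); ring. Qed.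

Lemma sqr_normB x y : `|x - y| ^+ 2 = `|x| ^+ 2 - 2 * dot x y + `|y| ^+ 2.
Proof. by rewrite sqr_normD dotNr normrN; ring. Qed.

(* Cauchy-Schwarz is the triangle inequality, squared. *)
Lemma dot_le x y : dot x y <= `|x| * `|y|.
Proof.
have : `|x + y| ^+ 2 <= (`|x| + `|y|) ^+ 2.
  by rewrite ler_sqr ?nnegrE ?addr_ge0// ler_normD.
by rewrite sqr_normD; lra.
Qed.

Lemma norm_dot_le x y : `|dot x y| <= `|x| * `|y|.
Proof.
by rewrite ler_norml dot_le andbT lerNl -dotNl (le_trans (dot_le _ _))// normrN.
Qed.

Lemma dot_inj x y : (forall h, dot x h = dot y h) -> x = y.
Proof.
move=> xy; apply/eqP; rewrite -subr_eq0 -normr_eq0 -sqrf_eq0 norm_dot dotDl dotNl.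
by rewrite xy subrr.
Qed.

Fact riesz_subproof x : (dot x : H -> R^o) \in @contlin R H R^o.
Proof.
apply: (@bounded_contlin _ _ _ _ `|x|) => [a u v|y]; last exact: norm_dot_le.
by rewrite dotDr dotZr.
Qed.

Definition riesz_fun x := ContlinMap (riesz_subproof x).

Fact riesz_fun_subproof : riesz_fun \in @contlin R H (contlinMap H R^o).
Proof.
apply: (@bounded_contlin _ _ _ _ 1) => [a u v|x].
  by apply/val_inj/funext => h /=; rewrite !fctE dotDl dotZl.
rewrite mul1r; apply: opnorm_le => h h1 /=.
by rewrite (le_trans (norm_dot_le _ _))// ler_piMr.
Qed.

Definition riesz := ContlinMap riesz_fun_subproof.

Section Representation.
Variable L : contlinMap H R^o.

Let LD x y : L (x + y) = L x + L y. Proof. exact: linearD. Qed.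

Let LZ a x : L (a *: x) = a * L x. Proof. exact: linearZ. Qed.

(** The quadratic energy whose minimizer represents [L]. *)
Let J x : R := `|x| ^+ 2 / 2 - L x.

Let J_lb x : - (`|L| ^+ 2 / 2) <= J x.
Proof.
have LX : L x <= `|L| * `|x| := le_trans (ler_norm _) (opnorm_bound L x).
have := sqr_ge0 (`|x| - `|L|); rewrite /J; lra.
Qed.

Let m := inf (range J).

Let m_lb x : m <= J x.
Proof.
by apply: ge_inf; [exists (- (`|L| ^+ 2 / 2)) => _ [y _ <-]|exists x].
Qed.

(* Parallelogram identity at the midpoint of x and y. *)
Let J_dist x y : `|x - y| ^+ 2 <= 4 * ((J x - m) + (J y - m)).
Proof.
have := m_lb (2^-1 *: (x + y)); rewrite /J LZ LD.
rewrite normrZ ger0_norm ?invr_ge0// exprMn sqr_normB sqr_normD.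
lra.
Qed.

(** By [J_dist] a minimizing sequence is Cauchy; completeness gives a limit, and continuity of [J]
    makes it a minimizer. *)
Let J_min : exists x, forall y, J x <= J y.
Proof.
have /choice [u uP] : forall n, exists x, J x < m + n.+1%:R^-1.
  move=> n; have [] := @inf_adherent R (range J) n.+1%:R^-1.
  - by rewrite invr_gt0.
  - split; first by exists (J 0), 0.
    by exists (- (`|L| ^+ 2 / 2)) => _ [y _ <-].
  by move=> _ [x _ <-] Jx; exists x.
have u_cvg : cvg (u @ \oo).
  apply/cauchy_cvgP/cauchy_exP => e e0.
  (* Two excesses over [m], each below e^2/8, give a squared distance below 4 (e^2/8 + e^2/8) =
     e^2. *)
  have e8 : 0 < e ^+ 2 / 8 by rewrite divr_gt0 ?exprn_gt0.
  near \oo => N; exists (u N).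
  change (\forall n \near \oo, ball (u N) e (u n)); near=> n.
  rewrite -ball_normE /= -ltr_sqr ?nnegrE ?normr_ge0 ?(ltW e0)//.
  apply: (le_lt_trans (J_dist _ _)).
  have := uP N; have := uP n.
  have : N.+1%:R^-1 < e ^+ 2 / 8 by near: N; exact: near_infty_natSinv_lt (PosNum e8).
  have : n.+1%:R^-1 < e ^+ 2 / 8 by near: n; exact: near_infty_natSinv_lt (PosNum e8).
  move: n.+1%:R^-1 N.+1%:R^-1 (J _) (J _) (e ^+ 2) (m) => *; lra.
exists (lim (u @ \oo)) => y; apply: le_trans (m_lb y).
have Ju : J \o u @ \oo --> J (lim (u @ \oo)).
  apply: cvgB.
    by apply: cvgMl; rewrite expr2; apply: cvgM; apply: cvg_norm.
  by apply: cvg_comp u_cvg _; exact: contlin_continuous.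
have mu : (fun n => m + n.+1%:R^-1) @ \oo --> m.
  by rewrite -[X in _ --> X]addr0; apply: cvgD; [exact: cvg_cst|exact: cvg_harmonic].
apply: (ler_cvg_to Ju mu); near=> n; exact/ltW/uP.
Unshelve. all: by end_near. Qed.

(** The first-order optimality condition at a minimizer of [J], tested along the line through [x]
    with direction [h]. *)
Lemma riesz_representation : exists x, forall h, dot x h = L h.
Proof.
have [x xmin] := J_min; exists x => h.
have key t : 0 <= t * (dot x h - L h) + t ^+ 2 * (`|h| ^+ 2 / 2).
  have := xmin (x + t *: h); rewrite /J sqr_normD normrZ exprMn real_normK ?num_real//.
  rewrite LD LZ dotZr; lra.
have [h0|h0] := eqVneq `|h| 0.
  have := key 1; have := key (-1); rewrite h0; lra.
set d := dot x h - L h in key *.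
have hp : 0 < `|h| ^+ 2 by rewrite exprn_even_gt0.
(* This value of t minimizes the quadratic in [key]; its minimum -d^2/(2|h|^2) must be nonnegative,
   which forces d = 0. *)
have := key (- d / `|h| ^+ 2).
have -> : - d / `|h| ^+ 2 * d + (- d / `|h| ^+ 2) ^+ 2 * (`|h| ^+ 2 / 2) =
  - (d ^+ 2 / `|h| ^+ 2 / 2) by field.
rewrite oppr_ge0 pmulr_lle0// pmulr_lle0 ?invr_gt0// => d0.
by apply/eqP; rewrite -subr_eq0 -sqrf_eq0 eq_le d0 sqr_ge0.
Qed.

End Representation.

Definition riesz_inv_fun L := sval (cid (riesz_representation L)).

Lemma dot_riesz_inv L h : dot (riesz_inv_fun L) h = L h.
Proof. by rewrite /riesz_inv_fun; case: cid. Qed.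

(** If x represents L, then |x|^2 = L x <= |L| |x|, so the inverse is bounded by 1. *)
Fact riesz_inv_subproof : riesz_inv_fun \in @contlin R (contlinMap H R^o) H.
Proof.
apply: (@bounded_contlin _ _ _ _ 1) => [a L M|L].
  by apply: dot_inj => h; rewrite dotDl dotZl /= !dot_riesz_inv.
rewrite mul1r; set x := riesz_inv_fun L.
have [x0|x0] := eqVneq `|x| 0; first by rewrite x0.
rewrite -(@ler_pM2r _ `|x|) ?lt_def ?x0//= -expr2 norm_dot dot_riesz_inv.
exact: le_trans (ler_norm _) (opnorm_bound L x).
Qed.

Definition riesz_inv := ContlinMap riesz_inv_subproof.

Lemma rieszK x : riesz_inv (riesz x) = x.
Proof. by apply: dot_inj => h; rewrite dot_riesz_inv. Qed.

End Riesz.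

(** * Subgradient selections and differentiability *)

(** A one-sided bound suffices: shrinking [h] into the neighbourhood and using homogeneity gives u h
    <= e for every e, and -h gives the other sign. *)
Lemma contlin_littleo0 (R : realType) (V : normedModType R)
    (u : contlinMap V R^o) :
  (forall e : R, 0 < e -> \forall h \near 0, u h <= e * `|h|) ->
  forall h, u h = 0.
Proof.
move=> uo; have u_le0 h : (u h : R) <= 0.
  apply/(@ler_addgt0Pr R) => e e0; rewrite add0r.
  have n1 : 0 < `|h| + 1 by rewrite ltr_wpDl.
  (* The factor 1/(|h| + 1) absorbs |h| in the final bound, and stays meaningful when h = 0. *)
  have /uo /nbhs_norm0P[d /= d0 ud] : 0 < e / (`|h| + 1) by rewrite divr_gt0.
  have t0 : 0 < d / (`|h| + 1) by rewrite divr_gt0.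
  have /= := ud (d / (`|h| + 1) *: h).
  rewrite normrZ gtr0_norm// linearZ /= /GRing.scale /=.
  rewrite mulrCA ler_pM2l// => uh; apply: le_trans (uh _) _.
    by rewrite mulrAC ltr_pdivrMr// ltr_pM2l// ltrDl.
  by rewrite mulrAC ler_pdivrMr// ler_pM2l// lerDl.
move=> h; apply/eqP; rewrite eq_le u_le0 /= -oppr_le0 -linearN.
exact: u_le0.
Qed.

Section Subdifferential.
Context {R : realType} {H : completeNormedModType R}.
Context (dot : {dot H for @idfun R}).
Hypothesis norm_dot : forall x : H, `|x| ^+ 2 = dot x x.
Context (theta : H -> \bar R).
Hypothesis theta_ninfty : forall x, theta x != -oo%E.
Implicit Types (x y u : H) (X : set H).

Lemma subdiff_fin x u : subdiff dot theta x u -> theta x \is a fin_num.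
Proof. by case=> tx _; rewrite fin_numE theta_ninfty lt_eqF. Qed.

Lemma subdiff_fine x y u : subdiff dot theta x u -> theta y \is a fin_num ->
  dot u (y - x) <= fine (theta y) - fine (theta x).
Proof.
move=> ux fy; have fx := subdiff_fin ux; case: ux => _ /(_ y).
by rewrite -(fineK fx) -(fineK fy) -EFinD lee_fin /= lerBrDl.
Qed.

(** The subgradient inequality bounds the linear form <u, h> - df h above by the first-order
    remainder, which is o(|h|); hence it vanishes. *)
Lemma subdiff_diff x u (df : contlinMap H R^o) :
  (\forall z \near x, theta z \is a fin_num) ->
  is_diff x (fine \o theta : H -> R^o) df ->
  subdiff dot theta x u -> df = riesz norm_dot u.
Proof.
move=> tfin tdf ux; apply/eqP; rewrite eq_sym -subr_eq0; apply/eqP/val_inj/funext.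
apply: contlin_littleo0 => e e0.
have : \forall h \near 0, theta (h + x) \is a fin_num.
  by have := tfin; rewrite (near_shift 0) /= subr0.
have /is_diffP /(_ e e0) := tdf.
apply: filterS2 => h /= /ler_normlW hdf hfin.
have := subdiff_fine ux hfin; rewrite addrK.
move: hdf; rewrite /= !fctE; lra.
Qed.

Lemma subdiff_unique x u v (df : contlinMap H R^o) :
  (\forall z \near x, theta z \is a fin_num) ->
  is_diff x (fine \o theta : H -> R^o) df ->
  subdiff dot theta x u -> subdiff dot theta x v -> u = v.
Proof.
move=> tfin tdf ux vx; rewrite -(rieszK norm_dot u) -(rieszK norm_dot v).
by rewrite -(subdiff_diff tfin tdf ux) -(subdiff_diff tfin tdf vx).
Qed.

Context (X : set H) (s : H -> H).
Hypothesis X_open : open X.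
Hypothesis s_subdiff : forall x, X x -> subdiff dot theta x (s x).

Let near_X x : X x -> \forall z \near x, X z.
Proof. by move=> Xx; exact: open_nbhs_nbhs. Qed.

Let near_fin x : X x -> \forall z \near x, theta z \is a fin_num.
Proof. by move=> /near_X; apply: filterS => z /s_subdiff/subdiff_fin. Qed.

Lemma is_diff_continuous_subdiff x : X x -> {for x, continuous s} ->
  is_diff x (fine \o theta : H -> R^o) (riesz norm_dot (s x)).
Proof.
move=> Xx /cvgrPdist_le sc; apply/is_diffP => e e0.
have : \forall h \near 0, X (h + x).
  by have := near_X Xx; rewrite (near_shift 0) /= subr0.
have : \forall h \near 0, `|s x - s (h + x)| <= e.
  have : \forall z \near x, `|s x - s z| <= e by exact: sc.
  by rewrite (near_shift 0) /= subr0.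
apply: filterS2 => h she Xh /=.
have := subdiff_fine (s_subdiff Xx) (subdiff_fin (s_subdiff Xh)).
have := subdiff_fine (s_subdiff Xh) (subdiff_fin (s_subdiff Xx)).
rewrite addrK opprD addrCA subrr addr0 dotNr => lo hi.
(* Cauchy-Schwarz and the continuity of [s] turn the upper end of the squeeze into e |h|. *)
have shh : dot (s (h + x)) h - dot (s x) h <= e * `|h|.
  rewrite -dotNl -dotDl (le_trans (dot_le norm_dot _ _))// ler_wpM2r//.
  by rewrite distrC.
rewrite ger0_norm; lra.
Qed.

(** On [X] the derivative is [riesz] applied to [s], and [s] is [riesz_inv] applied to the
    derivative; both are continuous linear, so they preserve class C^k. *)
Lemma Ck_ereal_subdiff k : Ck_ereal k.+1 theta X <-> Ck k s X.
Proof.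
split=> [[_ [Dt tDt CDt]]|Cs].
  apply: eq_Ck (Ck_comp_contlin (riesz_inv norm_dot) CDt) => // x.
  rewrite inE => Xx /=; rewrite -[RHS](rieszK norm_dot); congr riesz_inv_fun.
  exact: subdiff_diff (near_fin Xx) (tDt x Xx) (s_subdiff Xx).
split=> [x /s_subdiff/subdiff_fin//|].
exists (riesz norm_dot \o s); last exact: Ck_comp_contlin.
by move=> x Xx; apply: is_diff_continuous_subdiff => //; exact: Ck_continuous Cs Xx.
Qed.

Lemma is_gradient_subdiff k x : Ck k s X -> X x -> is_gradient dot theta x (s x).
Proof.
move=> Cs Xx; split; first exact: near_fin.
exact: is_diff_continuous_subdiff Xx (Ck_continuous Cs Xx).
Qed.

(** A continuous selection makes [theta] differentiable, so the subdifferential is a singleton.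
    Injectivity of f will follow from this. *)
Lemma Ck_subdiff_unique k x u : Ck k s X -> X x -> subdiff dot theta x u ->
  u = s x.
Proof.
move=> Cs Xx ux.
have sdiff := is_diff_continuous_subdiff Xx (Ck_continuous Cs Xx).
exact: subdiff_unique (near_fin Xx) sdiff ux (s_subdiff Xx).
Qed.

End Subdifferential.

(** * Adding a smooth real-valued function *)

Section Perturbation.
Context {R : realType} {V : normedModType R}.
Implicit Types (theta : V -> \bar R) (X : set V).

Lemma Ck_erealD k theta (q : V -> R) X : open X -> Ck_ereal k theta X ->
  Ck k (q : V -> R^o) X -> Ck_ereal k (fun x => theta x + (q x)%:E)%E X.
Proof.
move=> oX [tfin Ct] Cq; split=> [x /tfin tx|]; first by rewrite fin_numD tx.
apply: eq_Ck (CkD Ct Cq) => // x; rewrite inE => /tfin tx /=.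
by rewrite fineD.
Qed.

Lemma Ck_ereal_perturb k theta (q : V -> R) X : open X ->
  Ck k (q : V -> R^o) X ->
  Ck_ereal k theta X <-> Ck_ereal k (fun x => theta x + (q x)%:E)%E X.
Proof.
move=> oX Cq; split=> Ct; first exact: Ck_erealD.
have CNq : Ck k (fun x => - q x : R^o) X.
  exact: (Ck_comp_contlin (- id_contlin R^o) Cq).
have := Ck_erealD oX Ct CNq; congr (Ck_ereal k _ X); apply/funext => x.
by rewrite EFinN addeK.
Qed.

End Perturbation.

(** * Proximity operators and the half squared norm *)

Section Proximity.
Context {R : realType} {H : completeNormedModType R}.
Context (dot : {dot H for @idfun R}).
Hypothesis norm_dot : forall x : H, `|x| ^+ 2 = dot x x.
Implicit Types (phi : H -> \bar R) (x y u : H) (X : set H).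

Let q x : R := 2^-1 * `|x| ^+ 2.

(** The gap in the subgradient inequality is exactly |x' - x|^2/2. *)
Lemma subdiff_half_sqr x : subdiff dot (EFin \o q) x x.
Proof.
split=> [|x']; rewrite /= ?ltry// -EFinD lee_fin /q.
have := sqr_ge0 (`|x' - x|); rewrite (sqr_normB norm_dot) dotDr dotNr -norm_dot.
rewrite (dotC dot x' x); lra.
Qed.

(** The identity selects subgradients of [q] and is continuous linear, so the equivalence for
    selections applies to [q] itself. *)
Lemma Ck_half_sqr k X : open X -> Ck k.+1 (q : H -> R^o) X.
Proof.
move=> oX; have half_ninfty x : (EFin \o q) x != -oo%E by [].
have [_] := (Ck_ereal_subdiff norm_dot half_ninfty oX
  (fun x _ => subdiff_half_sqr x) k).2 (Ck_contlin k (id_contlin H) X).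
exact.
Qed.

Lemma is_diff_half_sqr x : is_diff x (q : H -> R^o) (riesz norm_dot x).
Proof.
have idC : {for x, continuous (@idfun H)} by [].
have half_ninfty z : (EFin \o q) z != -oo%E by [].
exact: (is_diff_continuous_subdiff norm_dot half_ninfty openT
  (fun x _ => subdiff_half_sqr x) I idC).
Qed.

(** Once both squares are expanded, the terms |y|^2/2 cancel. *)
Lemma prox_subdiff phi x y : (forall x, phi x != -oo%E) ->
  prox phi y x -> subdiff dot (fun x => phi x + (q x)%:E)%E x y.
Proof.
move=> phin [phix phile]; split=> [|x']; first by rewrite lte_add_pinfty ?ltry.
have := phin x; have := phin x'; move: phix (phile x') => {phile}.
case: (phi x) => [a| |]//; case: (phi x') => [b| |]// _ + _ _; last first.
  by move=> _; rewrite addye// leey.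
rewrite -!EFinD !lee_fin /q !(sqr_normB norm_dot) dotDr dotNr; lra.
Qed.

Lemma is_gradient_half_sqr phi x u :
  is_gradient dot (fun x => phi x + (q x)%:E)%E x u ->
  is_gradient dot phi x (u - x).
Proof.
case=> hfin hdf; have pfin : \forall z \near x, phi z \is a fin_num.
  by apply: filterS hfin => z; rewrite fin_numD => /andP[].
split=> //.
have dq := is_diff_half_sqr x; have := is_diffB hdf dq.
have -> : (dot u : H -> R^o) - riesz norm_dot x = riesz norm_dot (u - x).
  by apply/funext => h /=; rewrite !fctE dotDl dotNl.
move=> /is_diffP hd; apply: (iffRL (is_diffP _ (riesz norm_dot (u - x)) x)) => e e0.
(* Finiteness of [phi] near x is what makes [fine] additive in the difference below. *)
have phifin : \forall h \near 0, phi (h + x) \is a fin_num.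
  by move: pfin; rewrite (near_shift 0) /= subr0.
have phix : phi x \is a fin_num by exact: nbhs_singleton pfin.
apply: filterS2 phifin (hd e e0) => h phih; rewrite !fctE /=.
by rewrite !fineD//= !addrK.
Qed.

End Proximity.

Theorem corollary6 (R : realType) (H : completeNormedModType R)
    (dot : {dot H for @idfun R})
    (norm_dot : forall x : H, `|x| ^+ 2 = dot x x)
    (Y : set H) (f : H -> H) (phi g psi : H -> \bar R)
    (phi_ninfty : forall x, phi x != -oo%E)
    (g_ninfty : forall x, g x != -oo%E)
    (psi_ninfty : forall x, psi x != -oo%E)
    (f_prox : forall y, Y y -> prox phi y (f y))
    (g_convex : ereal_convex g)
    (g_lsc : lower_semicontinuous g)
    (g_subdiff : forall x, (f @` Y) x ->
       Y `&` f @^-1` [set x] `<=` subdiff dot g x)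
    (psi_convex : ereal_convex psi)
    (psi_lsc : lower_semicontinuous psi)
    (psi_subdiff : forall y, Y y -> subdiff dot psi y (f y))
    (k : nat) :
  (forall V : set H, open V -> V `<=` Y ->
     (Ck_ereal k.+1 psi V <-> Ck k f V) /\
     (Ck_ereal k.+1 psi V \/ Ck k f V ->
      forall y, V y -> is_gradient dot psi y (f y))) /\
  (forall X : set H, open X -> X `<=` f @` Y ->
     let D := Y `&` f @^-1` X in
     let finv := 'pinv_(fun=> 0) D f in
     let phi_Ck := Ck_ereal k.+1 phi X in
     let g_Ck := Ck_ereal k.+1 g X in
     let finv_Ck := set_inj D f /\ Ck k finv X in
     (phi_Ck <-> g_Ck) /\ (g_Ck <-> finv_Ck) /\
     (phi_Ck \/ g_Ck \/ finv_Ck ->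
      set_bij D X f /\
      forall x, X x ->
        is_gradient dot g x (finv x) /\
        exists2 u, is_gradient dot phi x u & finv x = x + u)).
Proof.
split=> [V oV VY|X oX XY D finv phi_Ck g_Ck finv_Ck].
  (* Part (a): [f] is itself the selection of subgradients of [psi]. *)
  have sV y : V y -> subdiff dot psi y (f y) by move=> /VY; exact: psi_subdiff.
  have psiE := Ck_ereal_subdiff norm_dot psi_ninfty oV sV k.
  split=> // Cf y Vy; have {}Cf : Ck k f V by case: Cf => [/psiE|].
  exact: (is_gradient_subdiff norm_dot psi_ninfty oV sV Cf Vy).
(* Part (b): [f] maps [D] onto [X], so on [X] the partial inverse takes genuine preimages in [D] and
   never its default value 0. *)
have surjf : set_surj D X f.
  move=> x Xx; have [y Yy yx] := XY x Xx.
  by exists y => //; split=> //; rewrite /preimage /= yx.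
have finvD x : X x -> D (finv x).
  by move=> Xx; apply: (surjpinv_image_sub surjf); exists x.
have finvK x : X x -> f (finv x) = x.
  by move=> Xx; apply: (surjpK _ surjf); rewrite inE.
(* The proximity condition makes [finv] select subgradients of this function, as it does for [g]. *)
pose h x := (phi x + (2^-1 * `|x| ^+ 2)%:E)%E.
have h_ninfty x : h x != -oo%E by rewrite /h adde_eq_ninfty negb_or phi_ninfty.
have gD y : D y -> subdiff dot g (f y) y.
  by move=> [Yy _]; apply: g_subdiff => //; exists y.
have gX x : X x -> subdiff dot g x (finv x).
  by move=> Xx; rewrite -{1}(finvK x Xx); exact/gD/finvD.
have hX x : X x -> subdiff dot h x (finv x).
  move=> Xx; have [Yx _] := finvD x Xx; rewrite -{1}(finvK x Xx).
  exact/prox_subdiff/f_prox.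
have gE : g_Ck <-> Ck k finv X := Ck_ereal_subdiff norm_dot g_ninfty oX gX k.
have phiE : phi_Ck <-> Ck k finv X.
  apply: iff_trans (Ck_ereal_subdiff norm_dot h_ninfty oX hX k).
  exact/Ck_ereal_perturb/Ck_half_sqr.
(* Two points of [D] with the same image x are both subgradients of [g] at x, hence both equal
   [finv x]. *)
have inj : Ck k finv X -> set_inj D f.
  move=> Cf y z; rewrite !inE => Dy Dz fyz.
  have uniq := Ck_subdiff_unique norm_dot g_ninfty oX gX Cf.
  have [_ Xy] := Dy; rewrite (uniq (f y) y)//; last exact: gD.
  by apply/esym/uniq => //; rewrite fyz; exact: gD.
have finvE : finv_Ck <-> Ck k finv X.
  by split=> [[]//|Cf]; split=> //; exact: inj.
split; first by rewrite phiE gE.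
split; first by rewrite gE finvE.
rewrite phiE gE finvE => CC; have {CC}Cf : Ck k finv X by case: CC => [|[|]].
split; first by split=> //; [move=> y []|exact: inj].
move=> x Xx; split.
  exact: (is_gradient_subdiff norm_dot g_ninfty oX gX Cf Xx).
(* The gradient of [h] at x is [finv x]; that of the half squared norm is x. *)
exists (finv x - x); last by rewrite addrC subrK.
apply: is_gradient_half_sqr => //.
exact: (is_gradient_subdiff norm_dot h_ninfty oX hX Cf Xx).
Qed.
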